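(* The map $\mathbb B_\infty\to\mathbb V_\infty(\overline K)$, $[\mathcal B]\mapsto\omega_{\mathcal B}$, is well defined and bijective.
   Context: $(K,v)$ is a valued field, $\overline K$ an algebraic closure, $\bar v$ a fixed extension of $v$ to $\overline K$ with value group $\Gamma$. Closed balls: $B(a,\gamma)=\{c\in\overline K\mid\bar v(c-a)\ge\gamma\}$ for $a\in\overline K,\gamma\in\Gamma$; $\omega_{B(a,\gamma)}(\sum a_n(x-a)^n)=\min_n\{\bar v(a_n)+n\gamma\}$. $\mathcal N_\infty$ is the set of nests $\mathcal B=(B_i)_{i\in I}$ of closed balls ($I$ totally ordered, $i<j\iff B_i\supsetneq B_j$) with $\bigcap_i B_i=\emptyset$; for such $\mathcal B$, $\omega_{\mathcal B}(f)=\max_i\omega_{B_i}(f)$ for $f\in\overline K[x]$ (the values stabilize). Two nests are equivalent, $\mathcal B\sim\mathcal C$, if they are mutually cofinal (each ball of one contains some ball of the other); $\mathbb B_\infty=\mathcal N_\infty/\sim$. $\mathbb V_\infty(\overline K)$ is the set of valuations $\omega$ on $\overline K(x)$ extending $\bar v$ that are valuation-algebraic: $\Gamma_\omega/\Gamma$ is torsion (so $\Gamma_\omega=\Gamma$ after the canonical identification) and the residue field extension of $\omega$ over that of $\bar v$ is algebraic. *)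

(* Defs.v *)
From HB Require Import structures.
From mathcomp Require Import all_boot all_order all_algebra.
From mathcomp Require Import fraction.
Set Implicit Arguments. Unset Strict Implicit. Unset Printing Implicit Defensive.
Import Order.TTheory GRing.Theory Num.Theory.
Local Open Scope ring_scope.


Definition ordered_group (G : Num.POrderedZmodule.type) : Prop :=
  (forall x y : G, (x <= y) || (y <= x)) /\
  (forall x y z : G, x <= y -> x + z <= y + z).

Section Valued.
Variable (G : porderZmodType).

(* Gamma ∪ {∞}, with None = ∞ *)
Definition oadd (a b : option G) : option G :=
  match a, b with Some x, Some y => Some (x + y) | _, _ => None end.
Definition ole (a b : option G) : bool :=
  match a, b with
  | _, None => true
  | None, Some _ => false
  | Some x, Some y => x <= y end.
Definition olt (a b : option G) : bool := ole a b && (a != b).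
Definition omin (a b : option G) : option G := if ole a b then a else b.

Definition is_valuation (F : fieldType) (w : F -> option G) : Prop :=
  (forall x : F, w x = None <-> x = 0) /\
  (forall x y : F, w (x * y) = oadd (w x) (w y)) /\
  (forall x y : F, ole (omin (w x) (w y)) (w (x + y))).

Variables (L : closedFieldType) (vbar : L -> option G).

Definition ball (B : L * G) : L -> Prop :=
  fun c => ole (Some B.2) (vbar (c - B.1)).

Definition ball_sub (B C : L * G) : Prop := forall c, ball B c -> ball C c.

(* omega_{B(a,gamma)} (sum a_n (x-a)^n) = min_n (vbar a_n + n gamma) *)
Definition omega_ball (B : L * G) (p : {poly L}) : option G :=
  let q := p \Po ('X + (B.1)%:P) in
  \big[omin/None]_(n < size q) oadd (vbar q`_n) (Some (B.2 *+ n)).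

(* A nest of closed balls with empty intersection: a family of balls
   (indexed by itself) totally ordered by inclusion, distinct indices giving
   distinct balls, with empty intersection. *)
Definition is_nest (N : L * G -> Prop) : Prop :=
  (forall B C, N B -> N C -> ball_sub B C \/ ball_sub C B) /\
  (forall B C, N B -> N C -> (forall c, ball B c <-> ball C c) -> B = C) /\
  ~ (exists c : L, forall B, N B -> ball B c).

Definition nest_equiv (N M : L * G -> Prop) : Prop :=
  (forall B, N B -> exists C, M C /\ ball_sub C B) /\
  (forall C, M C -> exists B, N B /\ ball_sub B C).

Local Notation Lx := {fraction {poly L}}.
Local Notation tofracL := (@FracField.tofrac {poly L}).

(* residue field extension algebraic: the residue class of every f with
   w f >= 0 is a root of a nonzero polynomial over the residue field of vbar *)
Definition residue_algebraic (w : Lx -> option G) : Prop :=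
  forall f : Lx, ole (Some 0%R) (w f) ->
    exists P : {poly L},
      (forall i, ole (Some 0%R) (vbar P`_i)) /\
      (exists i, vbar P`_i = Some 0%R) /\
      olt (Some 0%R) (w (map_poly (fun c : L => tofracL (c%:P)) P).[f]).

(* V_infty(Kbar): valuations on Kbar(x) extending vbar, with value group
   (identified with) Gamma, and algebraic residue field extension *)
Definition V_infty (w : Lx -> option G) : Prop :=
  is_valuation w /\ (forall c : L, w (tofracL (c%:P)) = vbar c) /\
  residue_algebraic w.

Definition induced_by (N : L * G -> Prop) (w : Lx -> option G) : Prop :=
  forall p : {poly L},
    exists B, N B /\ w (tofracL p) = omega_ball B p /\
      forall C, N C -> ole (omega_ball C p) (w (tofracL p)).

End Valued.

(* Main.v *)
(** A nest with empty intersection eventually avoids the finitely many zeros and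
    poles of a rational function [f]. On a ball [B] without zeros or poles of
    [f], any two values of [f] differ by a factor [1 + e] with [e] of positive
    value; so [v (f c)] is constant for [c] in [B], equal to [omega_B f] when [f]
    is a polynomial, and [w f] is this eventual constant. The residue of [f] is
    the residue of one of its values, so the residue field does not grow.

    Conversely, for [w] valuation-algebraic, the set of values [w (x - a)] has
    no maximum: otherwise some [f = (x - a) / c] would have a residue outside
    the residue field of [v], yet algebraic over it, which is impossible because
    [L] is algebraically closed. Hence the balls [B(a, w (x - a))] form a nest
    with empty intersection. A root [r] outside such a ball satisfies
    [w (x - r) = v (a - r)], and factoring polynomials into linear factors shows
    that this nest induces [w]. *)

Require Import Defs.
From HB Require Import structures.
From mathcomp Require Import all_boot all_order all_algebra.
From mathcomp Require Import fraction generic_quotient ring.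
From Stdlib Require Import Classical ClassicalEpsilon FunctionalExtensionality.

Set Implicit Arguments. Unset Strict Implicit. Unset Printing Implicit Defensive.
Import Order.TTheory GRing.Theory Num.Theory.
Local Open Scope ring_scope.

(** * Order and addition on values extended by infinity *)

Section OrderedGroup.
Variables (G : porderZmodType) (HG : ordered_group G).
Implicit Types (a b c : option G).

Lemma oaddC a b : oadd a b = oadd b a.
Proof. by case: a b => [x|] [y|] //=; rewrite addrC. Qed.

Lemma oaddA a b c : oadd a (oadd b c) = oadd (oadd a b) c.
Proof. by case: a b c => [x|] [y|] [z|] //=; rewrite addrA. Qed.

Lemma oadd0 a : oadd a (Some 0) = a.
Proof. by case: a => [x|] //=; rewrite addr0. Qed.

Lemma oaddI a : a <> None -> injective (oadd a).
Proof. by case: a => // x _ [y|] [z|] //= [/addrI ->]. Qed.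

Lemma ole_refl a : ole a a.
Proof. by case: a => /=. Qed.

Lemma ole_None a : ole a None.
Proof. by case: a. Qed.

Lemma ole_trans a b c : ole a b -> ole b c -> ole a c.
Proof. by case: a b c => [x|] [y|] [z|] //=; apply: le_trans. Qed.

Lemma ole_anti a b : ole a b -> ole b a -> a = b.
Proof.
case: a b => [x|] [y|] //= xy yx.
by congr Some; apply: le_anti; rewrite xy.
Qed.

Lemma ole_total a b : ole a b || ole b a.
Proof. by case: a b => [x|] [y|] //=; apply: HG.1. Qed.

Lemma oltNge a b : olt a b = ~~ ole b a.
Proof.
rewrite /olt; case: (boolP (ole b a)) => [ba|nba].
  by apply/negP => /andP[ab /eqP]; apply; apply: ole_anti.
have := ole_total a b; rewrite (negPf nba) orbF => ->; apply/eqP => ab.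
by rewrite ab ole_refl in nba.
Qed.

Lemma oltW a b : olt a b -> ole a b.
Proof. by case/andP. Qed.

Lemma olt_trans_le a b c : olt a b -> ole b c -> olt a c.
Proof.
by rewrite !oltNge => ab bc; apply: contra ab => ca; apply: ole_trans ca.
Qed.

Lemma ole_add a b c d : ole a b -> ole c d -> ole (oadd a c) (oadd b d).
Proof.
case: a b c d => [x|] [y|] [z|] [t|] //= xy zt.
by apply: le_trans (HG.2 _ _ _ xy) _; rewrite ![y + _]addrC; apply: HG.2.
Qed.

Lemma olt_add2r a b c : c <> None -> olt a b -> olt (oadd a c) (oadd b c).
Proof.
move=> c0 /andP[ab /eqP nab]; apply/andP; split.
  by rewrite ole_add ?ole_refl.
by apply/eqP; rewrite ![oadd _ c]oaddC => /(oaddI c0).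
Qed.

Lemma ole_omin a b c : ole c (omin a b) = ole c a && ole c b.
Proof.
rewrite /omin; case: ifP => ab; apply/idP/andP => [ca|[]//]; split=> //.
  exact: ole_trans ab.
by have := ole_total a b; rewrite ab => /(ole_trans ca).
Qed.

Lemma ole_subr a b (h : G) :
  ole a (oadd b (Some h)) = ole (oadd a (Some (- h))) b.
Proof.
case: a b => [x|] [y|] //=; apply/idP/idP => /HG.2.
  by move/(_ (- h)); rewrite addrK.
by move/(_ h); rewrite subrK.
Qed.

Lemma ole_big_omin (I : Type) (r : seq I) (F : I -> option G) c :
  (forall i, ole c (F i)) -> ole c (\big[@omin G/None]_(i <- r) F i).
Proof.
move=> cF; elim/big_rec: _ => [|i b _ cb]; first exact: ole_None.
by rewrite ole_omin cF.
Qed.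

Lemma big_omin_le (I : eqType) (r : seq I) (F : I -> option G) i :
  i \in r -> ole (\big[@omin G/None]_(j <- r) F j) (F i).
Proof.
elim: r => // j r IH; rewrite inE big_cons.
set m := (X in omin _ X) in IH *.
have: ole (omin (F j) m) (omin (F j) m) by apply: ole_refl.
rewrite ole_omin => /andP[le1 le2].
by case/predU1P => [->|/IH]; [exact: le1 | exact: ole_trans].
Qed.

(** * Ultrametric calculus of a valuation, and its one-units *)

Section Valuation.
Variables (F : fieldType) (w : F -> option G) (Hw : is_valuation w).
Implicit Types (x y : F).

Lemma val_None x : w x = None <-> x = 0.
Proof. exact: Hw.1. Qed.

Lemma val0 : w 0 = None.
Proof. by apply/val_None. Qed.

Lemma val_neq0 x : x != 0 -> w x <> None.
Proof. by move=> /eqP x0 /val_None. Qed.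

Lemma valM x y : w (x * y) = oadd (w x) (w y).
Proof. exact: Hw.2.1. Qed.

Lemma val1 : w 1 = Some 0.
Proof.
have n1 := val_neq0 (oner_neq0 F).
by apply: (oaddI n1); rewrite -valM mulr1 oadd0.
Qed.

(** Since (-1)^2 = 1, the value g of -1 satisfies g = -g; comparing g with 0 in the total order
    forces g = 0. *)
Lemma valN x : w (- x) = w x.
Proof.
rewrite -mulN1r valM oaddC.
have: oadd (w (-1)) (w (-1)) = Some 0 by rewrite -valM mulrNN mulr1 val1.
case: (w (-1)) => //= g [g2].
suff -> : g = 0 by rewrite oadd0.
have gE : g = - g by apply/eqP; rewrite -addr_eq0 g2.
have /orP[h|h] := HG.1 0 g.
  by apply: le_anti; rewrite h andbT {1}gE; have := HG.2 _ _ (- g) h;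
     rewrite add0r subrr.
by apply: le_anti; rewrite h /= gE; have := HG.2 _ _ (- g) h;
   rewrite add0r subrr.
Qed.

Lemma valBC x y : w (x - y) = w (y - x).
Proof. by rewrite -valN opprB. Qed.

Lemma valD_ge c x y : ole c (w x) -> ole c (w y) -> ole c (w (x + y)).
Proof.
by move=> cx cy; apply: ole_trans (Hw.2.2 x y); rewrite ole_omin cx cy.
Qed.

Lemma valB_ge c x y : ole c (w x) -> ole c (w y) -> ole c (w (x - y)).
Proof. by move=> cx cy; apply: valD_ge; rewrite ?valN. Qed.

Lemma valD_gt c x y : olt c (w x) -> olt c (w y) -> olt c (w (x + y)).
Proof.
move=> cx cy; have /orP[h|h] := ole_total (w x) (w y).
  by apply: olt_trans_le cx _; apply: valD_ge => //; apply: ole_refl.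
by apply: olt_trans_le cy _; apply: valD_ge => //; apply: ole_refl.
Qed.

Lemma valD_lt x y : olt (w x) (w y) -> w (x + y) = w x.
Proof.
move=> xy; apply: ole_anti; last first.
  by apply: valD_ge; [exact: ole_refl | exact: oltW].
have := ole_total (w x) (w (x + y)) => /orP[h|//].
rewrite -[ole _ _]negbK -oltNge; apply/negP => lt.
have := valD_gt lt (y := - y); rewrite valN addrK => /(_ xy).
by rewrite oltNge ole_refl.
Qed.

Lemma valX_ge g x n : ole (Some g) (w x) -> ole (Some (g *+ n)) (w (x ^+ n)).
Proof.
move=> gx; elim: n => [|n IH]; first by rewrite expr0 mulr0n val1 ole_refl.
by rewrite exprS mulrS valM; apply: (ole_add gx IH).
Qed.

Lemma val_div_eq x y z t : y != 0 -> t != 0 ->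
  w x = w z -> w y = w t -> w (x / y) = w (z / t).
Proof.
move=> y0 t0 xz yt; apply: (oaddI (val_neq0 y0)); rewrite {2}yt -!valM.
by rewrite ![_ * (_ / _)]mulrC !divfK.
Qed.

(** The subgroup 1 + m of the units, with m the maximal ideal: two nonzero elements with quotient in
    it have equal value and the same leading behaviour. *)
Definition one_unit x := olt (Some 0) (w (x - 1)).

Lemma one_unit_val x : one_unit x -> w x = Some 0.
Proof.
by rewrite /one_unit -val1 => /valD_lt; rewrite addrC subrK val1.
Qed.

Lemma one_unit1 : one_unit 1.
Proof. by rewrite /one_unit subrr val0. Qed.

Lemma one_unitM x y : one_unit x -> one_unit y -> one_unit (x * y).
Proof.
move=> ux uy; have -> : x * y = (x - 1) * y + y by rewrite mulrBl mul1r subrK.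
rewrite /one_unit -addrA; apply: valD_gt => //.
by rewrite valM (one_unit_val uy) oadd0.
Qed.

Lemma one_unitV x : one_unit x -> one_unit x^-1.
Proof.
move=> ux; have x0 : x != 0.
  by apply/eqP => x0; have := one_unit_val ux; rewrite x0 val0.
have wV : w x^-1 = Some 0.
  apply: (oaddI (val_neq0 x0)).
  by rewrite -valM divff // val1 (one_unit_val ux) oadd0.
have xV1 : x^-1 - 1 = (1 - x) * x^-1 by rewrite mulrBl mul1r divff.
by rewrite /one_unit xV1 valM wV oadd0 valBC.
Qed.

End Valuation.

End OrderedGroup.

(** Induction on the linear factors; the leading coefficient is the constant base case. *)
Lemma closed_poly_ind (L : closedFieldType) (P : {poly L} -> Prop) :
  (forall c, P c%:P) -> (forall p r, P p -> P (p * ('X - r%:P))) ->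
  forall p, P p.
Proof.
move=> Pc PM p; have [s ->] := closed_field_poly_normal p.
rewrite -mul_polyC mulrC; elim: s => [|r s IH].
  by rewrite big_nil mul1r; apply: Pc.
by rewrite big_cons -mulrA mulrC; apply: PM.
Qed.

(** * Polynomials on a closed ball *)

Section Balls.
Variables (G : porderZmodType) (HG : ordered_group G).
Variables (L : closedFieldType) (v : L -> option G) (Hv : is_valuation v).
Implicit Types (B C D : L * G) (p q : {poly L}).

(** Multiplying [p] by X - r turns the coefficient p_n into p_(n-1) - r p_n. The bound of w (e - r)
    by [g] handles the first term, the bound by [v r] the second. Used with e = 0 to find the
    minimal Taylor term on a ball, and with g = 0 to exclude new algebraic residues. *)
Lemma coef_val_ge (E : fieldType) (w : E -> option G)
    (iota : {rmorphism L -> E}) (e : E) (g : G) p :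
    is_valuation w -> (forall x, w (iota x) = v x) ->
    (forall r, root p r -> ole (w (e - iota r)) (Some g) /\
                           ole (w (e - iota r)) (v r)) ->
  forall n, ole (w (map_poly iota p).[e]) (oadd (v p`_n) (Some (g *+ n))).
Proof.
move=> Hw wv; elim/closed_poly_ind: p => [c|p r IH] rts n.
  rewrite map_polyC hornerC wv coefC; case: eqP => [->|_].
    by rewrite mulr0n oadd0 ole_refl.
  by rewrite val0 // ole_None.
have [le_g le_r] : ole (w (e - iota r)) (Some g) /\ ole (w (e - iota r)) (v r).
  by apply: rts; rewrite rootM root_XsubC eqxx orbT.
have {rts}IH : forall m, ole (w (map_poly iota p).[e]) (oadd (v p`_m) (Some (g *+ m))).
  by apply: IH => s ps; apply: rts; rewrite rootM ps.
rewrite rmorphM hornerM rmorphB /= map_polyX map_polyC hornerXsubC /=.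
rewrite (valM Hw) [p * _]mulrBr coefB coefMX coefMC.
rewrite ole_subr //; apply: (valB_ge HG Hv); rewrite -ole_subr //.
  case: n => [|n] /=; first by rewrite val0 // ole_None.
  by rewrite mulrSr; have := ole_add HG (IH n) le_g; rewrite -oaddA.
rewrite (valM Hv) -oaddA [oadd (v r) _]oaddC oaddA.
exact: (ole_add HG (IH n) le_r).
Qed.

Lemma ball_center B : ball v B B.1.
Proof. by rewrite /ball subrr val0. Qed.

(** Seen from a point outside the ball, all points of the ball are equally far, at a value below the
    radius. *)
Lemma ballPn B c : ~~ ole (Some B.2) (v (c - B.1)) ->
  forall b, ball v B b -> olt (v (b - c)) (Some B.2) /\ v (b - c) = v (B.1 - c).
Proof.
move=> cB b bB.
have lt : olt (v (B.1 - c)) (Some B.2) by rewrite valBC // oltNge.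
have -> : v (b - c) = v (B.1 - c); last by [].
have -> : b - c = B.1 - c + (b - B.1) by rewrite [RHS]addrC addrA subrK.
by apply: valD_lt => //; apply: olt_trans_le bB.
Qed.

Definition root_free B p := forall c, ball v B c -> ~~ root p c.

Lemma root_free_sub B C p : ball_sub v C B -> root_free B p -> root_free C p.
Proof. by move=> CB Bp c /CB /Bp. Qed.

Lemma root_freeM B p q : root_free B (p * q) -> root_free B p /\ root_free B q.
Proof. by move=> h; split=> c /h; rewrite rootM negb_or => /andP[]. Qed.

Lemma root_free_XsubC B r :
  root_free B ('X - r%:P) -> ~~ ole (Some B.2) (v (r - B.1)).
Proof.
by move=> Br; apply/negP => /Br; rewrite root_XsubC eqxx.
Qed.

(* [p.[c] / p.[c']] is a product of factors [1 + (c - c') / (c' - r)] over the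
   roots [r] of [p], all of which lie outside [B]. *)
Lemma root_free_one_unit B p c c' : root_free B p -> ball v B c -> ball v B c' ->
  one_unit v (p.[c] / p.[c']).
Proof.
move=> Bp Bc Bc'; elim/closed_poly_ind: p Bp => [a|p r IH] Bp.
  have := Bp _ Bc; rewrite rootC !hornerC => a0.
  by rewrite divff //; apply: one_unit1.
have [/IH up /root_free_XsubC rB] := root_freeM Bp.
rewrite !hornerM !hornerXsubC invfM mulrACA; apply: one_unitM => //.
have [lt _] := ballPn rB Bc'.
have cr0 : c' - r != 0.
  by apply/eqP => cr0; move: lt; rewrite cr0 val0.
have quoE : (c - r) / (c' - r) - 1 = (c - c') / (c' - r).
  by rewrite -(divff cr0) -mulrBl opprB addrA subrK.
rewrite /one_unit quoE.
(* Writing 0 as the value of a quotient with the same denominator reduces the goal to v (c' - r) < v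
   (c - c'). *)
have /eqP -> : Some 0 == v ((c' - r) / (c' - r)) by rewrite divff // val1.
rewrite !(valM Hv); apply: olt_add2r => //.
  by apply: val_neq0 => //; rewrite invr_neq0.
apply: olt_trans_le lt _ => //.
have -> : c - c' = (c - B.1) - (c' - B.1) by rewrite opprB addrA subrK.
exact: (valB_ge HG Hv).
Qed.

Lemma root_free_val B p c c' : root_free B p -> ball v B c -> ball v B c' ->
  v p.[c] = v p.[c'].
Proof.
move=> Bp Bc Bc'; have e := one_unit_val HG Hv (root_free_one_unit Bp Bc Bc').
have pc'0 : p.[c'] != 0 by apply: Bp.
by rewrite -(divfK pc'0 p.[c]) (valM Hv) e oaddC oadd0.
Qed.

Lemma omega_ball_le B p c : ball v B c -> ole (omega_ball v B p) (v p.[c]).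
Proof.
move=> Bc; rewrite /omega_ball; set q := p \Po _.
have -> : p.[c] = q.[c - B.1].
  by rewrite horner_comp hornerD hornerX hornerC subrK.
rewrite horner_coef; set m := \big[_/_]_(n < _) _.
have: forall n : 'I_(size q), ole m (v (q`_n * (c - B.1) ^+ n)).
  move=> n; rewrite (valM Hv).
  have mle := @big_omin_le G HG _ (index_enum 'I_(size q))
    (fun n : 'I_(size q) => oadd (v q`_n) (Some (B.2 *+ n))) n
    (mem_index_enum _).
  apply: (ole_trans mle); apply: ole_add => //; first exact: ole_refl.
  exact: valX_ge.
move=> mq; elim/big_rec: _ => [|n x _ mx]; first by rewrite val0 // ole_None.
exact: (valD_ge HG Hv).
Qed.

(** The roots of the Taylor polynomial at the center all have value below the radius, so the minimum
    is attained by the constant term, which is the value of [p] at the center. *)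
Lemma omega_ball_root_free B p c : root_free B p -> ball v B c ->
  omega_ball v B p = v p.[c].
Proof.
move=> Bp Bc; rewrite (root_free_val Bp Bc (ball_center B)).
apply: ole_anti; first exact/omega_ball_le/ball_center.
rewrite /omega_ball; set q := p \Po _.
apply: ole_big_omin => // n.
have -> : p.[B.1] = (map_poly (@idfun L) q).[0].
  by rewrite map_poly_id // horner_comp hornerD hornerX hornerC add0r.
apply: (@coef_val_ge L v idfun 0 B.2 q Hv) => // r.
rewrite sub0r valN // root_comp hornerD hornerX hornerC => rq.
split; last exact: ole_refl.
have := ole_total HG (v r) (Some B.2); case/orP => // Br.
have: ball v B (r + B.1) by rewrite /ball addrK.
by move/Bp; rewrite rq.
Qed.
End Balls.

Lemma fracE (R : idomainType) (f : {fraction R}) :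
  exists n d : R, d != 0 /\ f = FracField.tofrac n / FracField.tofrac d.
Proof.
elim/quotW: f => x; exists \n_x, \d_x; split; first exact: denom_ratioP.
have d0 : FracField.tofrac \d_x != 0 by rewrite tofrac_eq0 denom_ratioP.
apply: (mulIf d0); rewrite divfK //; unlock FracField.tofrac.
rewrite -[LHS]FracField.pi_mul; apply/eqmodP; rewrite /= FracField.equivfE.
rewrite /FracField.mulf !numden_Ratio ?mulf_neq0 ?oner_eq0 ?denom_ratioP //.
by rewrite !mulr1 mulrC.
Qed.

(** * Nests of balls and the valuations they induce *)

Section Nests.
Variables (G : porderZmodType) (HG : ordered_group G).
Variables (L : closedFieldType) (v : L -> option G) (Hv : is_valuation v).
Implicit Types (B C D : L * G) (p q : {poly L}) (N M : L * G -> Prop).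
Implicit Types (f : {fraction {poly L}}) (w : {fraction {poly L}} -> option G).
Local Notation "p %:F" := (@FracField.tofrac {poly L} p) (at level 1).

Lemma omega_ball0 B : omega_ball v B 0 = None.
Proof. by rewrite /omega_ball comp_poly0 size_poly0 big_ord0. Qed.

Lemma frac_val_ext w w' : is_valuation w -> is_valuation w' ->
  (forall p, w p%:F = w' p%:F) -> w = w'.
Proof.
move=> Hw Hw' ww'; apply: functional_extensionality => f.
have [n [d [d0 ->]]] := fracE f.
have dF0 : d%:F != 0 by rewrite tofrac_eq0.
apply: (oaddI (val_neq0 Hw dF0)); rewrite {2}ww' -(valM Hw) -(valM Hw').
by rewrite mulrC divfK.
Qed.

Section Nest.
Variables (N : L * G -> Prop) (HN : is_nest v N).

Lemma nest_avoid c : exists B, N B /\ ~ ball v B c.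
Proof.
apply: NNPP => h; apply: HN.2.2; exists c => B NB.
by apply: NNPP => Bc; apply: h; exists B.
Qed.

Lemma nest_inter B C : N B -> N C ->
  exists D, N D /\ ball_sub v D B /\ ball_sub v D C.
Proof.
by move=> NB NC; case: (HN.1 _ _ NB NC) => h; [exists B | exists C];
  do !split=> //; move=> c.
Qed.

Lemma nest_root_free p : p != 0 -> exists B, N B /\ root_free v B p.
Proof.
elim/closed_poly_ind: p => [c|p r IH].
  (* [nest_avoid] only supplies some member here: an empty family would have every point in its
     intersection. *)
  rewrite polyC_eq0 => c0; have [B [NB _]] := nest_avoid 0.
  by exists B; split=> // x _; rewrite rootC.
rewrite mulf_eq0 negb_or => /andP[/IH[B [NB Bp]] _].
have [C [NC Cr]] := nest_avoid r; have [D [ND [DB DC]]] := nest_inter NB NC.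
exists D; split=> // c Dc; rewrite rootM negb_or Bp ?root_XsubC; last exact: DB.
by apply/eqP => cr; apply: Cr; rewrite -cr; apply: DC.
Qed.

(** A larger ball [C] contains [c]; on a smaller one [p] still has the constant value it has on [B].
    Hence the maximum over the nest is reached at any root-free member. *)
Lemma nest_root_free_max B C p c : N B -> root_free v B p -> ball v B c -> N C ->
  ole (omega_ball v C p) (v p.[c]).
Proof.
move=> NB Bp Bc NC; have [BC|CB] := HN.1 _ _ NB NC.
  exact/omega_ball_le/BC.
have Cc := ball_center Hv C.
rewrite (root_free_val HG Hv Bp Bc (CB _ Cc)).
exact: omega_ball_le.
Qed.

Lemma induced_by_val w B p c : induced_by v N w -> N B -> root_free v B p ->
  ball v B c -> w p%:F = v p.[c].
Proof.
move=> /(_ p)[C [NC [wC wmax]]] NB Bp Bc; apply: ole_anti.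
  by rewrite wC; apply: nest_root_free_max NB Bp Bc NC.
by rewrite -(omega_ball_root_free HG Hv Bp Bc); apply: wmax.
Qed.

Lemma val_induced_by w : w 0 = None ->
  (forall B p, N B -> root_free v B p -> w p%:F = v p.[B.1]) ->
  induced_by v N w.
Proof.
move=> w0 wE p; have [->|/nest_root_free[B [NB Bp]]] := eqVneq p 0.
  have [B [NB _]] := nest_avoid 0; exists B; split=> //.
  by rewrite tofrac0 w0 omega_ball0; split=> // C _; rewrite ole_None.
have Bc := ball_center Hv B.
exists B; split=> //; rewrite (wE B) // (omega_ball_root_free HG Hv Bp Bc).
by split=> // C NC; apply: (nest_root_free_max NB Bp Bc NC).
Qed.

(** * Eventual values of rational functions along a nest *)

Definition near (P : L -> Prop) := exists B, N B /\ forall c, ball v B c -> P c.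

Lemma near_and (P Q : L -> Prop) : near P -> near Q -> near (fun c => P c /\ Q c).
Proof.
move=> [B [NB BP]] [C [NC CQ]]; have [D [ND [DB DC]]] := nest_inter NB NC.
by exists D; split=> // c Dc; split; [apply/BP/DB | apply/CQ/DC].
Qed.

Lemma near_mono (P Q : L -> Prop) : (forall c, P c -> Q c) -> near P -> near Q.
Proof. by move=> PQ [B [NB BP]]; exists B; split=> // c /BP /PQ. Qed.

Lemma near_ex (P : L -> Prop) : near P -> exists c, P c.
Proof. by move=> [B [_ BP]]; exists B.1; apply/BP/ball_center. Qed.

Lemma near_neq0 p : p != 0 -> near (fun c => p.[c] != 0).
Proof. exact: nest_root_free. Qed.

(* [g] is the eventual value of [v (f c)] as [c] runs through the nest. *)
Definition nest_val f g := exists p q,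
  [/\ q != 0, f = p%:F / q%:F & near (fun c => v (p.[c] / q.[c]) = g)].

Lemma nest_val_ex f : exists g, nest_val f g.
Proof.
have [p [q [q0 ->]]] := fracE f; have [->|p0] := eqVneq p 0.
  exists None, 0, q; split=> //; apply: near_mono (near_neq0 q0) => c _.
  by rewrite horner0 mul0r val0.
have /nest_root_free[B [NB /root_freeM[Bp Bq]]] := mulf_neq0 p0 q0.
have BB := ball_center Hv B.
exists (v (p.[B.1] / q.[B.1])), p, q; split=> //; exists B; split=> // c Bc.
apply: val_div_eq => //; [exact: Bq | exact: Bq | |];
  exact: root_free_val Bc BB.
Qed.

(** The eventual value does not depend on the fraction chosen: two representations agree after
    cross-multiplication, hence at every point where both denominators are nonzero. *)
Lemma nest_val_near f g p q : nest_val f g -> q != 0 -> f = p%:F / q%:F ->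
  near (fun c => v (p.[c] / q.[c]) = g).
Proof.
move=> [p' [q' [q'0 -> pq']]] q0 e.
have {e}e : p' * q = p * q'.
  apply/eqP; rewrite -tofrac_eq !tofracM; move/eqP: e.
  by rewrite eqr_div ?tofrac_eq0.
apply: near_mono (near_and pq' (near_and (near_neq0 q0) (near_neq0 q'0))).
move=> c [<- [qc q'c]]; congr v; apply/eqP; rewrite eqr_div //.
by rewrite -!hornerM e.
Qed.

Lemma nest_val_inj f g g' : nest_val f g -> nest_val f g' -> g = g'.
Proof.
move=> [p [q [q0 fE pq]]] fg'.
by have [c [<- <-]] := near_ex (near_and pq (nest_val_near fg' q0 fE)).
Qed.

(** Each axiom reduces to the same axiom for [v] at points deep enough in the nest for the finitely
    many eventual conditions to hold together. *)
Lemma nest_val_valuation : exists w, is_valuation w /\ forall f, nest_val f (w f).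
Proof.
pose w f := proj1_sig (constructive_indefinite_description _ (nest_val_ex f)).
have wP f : nest_val f (w f) by rewrite /w; case: constructive_indefinite_description.
exists w; split=> //; split=> [f|]; [|split=> f f'].
- split=> [f0|->].
    have [p [q [q0 fE pq]]] := wP f.
    have [pE|p0] := eqVneq p 0; first by rewrite fE pE tofrac0 mul0r.
    have [c [[vc pc] qc]] :=
      near_ex (near_and (near_and pq (near_neq0 p0)) (near_neq0 q0)).
    by move: vc; rewrite f0 => /(val_None Hv)/eqP; rewrite mulf_eq0 invr_eq0
      (negPf pc) (negPf qc).
  apply: nest_val_inj (wP 0) _; exists 0, 1; split; first exact: oner_neq0.
    by rewrite tofrac0 mul0r.
  apply: near_mono (near_neq0 (oner_neq0 _)) => c _.
  by rewrite horner0 mul0r val0.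
- have [p [q [q0 fE pq]]] := wP f; have [p' [q' [q'0 f'E pq']]] := wP f'.
  apply: nest_val_inj (wP _) _; exists (p * p'), (q * q').
  split; first exact: mulf_neq0.
    by rewrite fE f'E !tofracM mulf_div.
  apply: near_mono (near_and pq pq') => c [<- <-].
  by rewrite -(valM Hv) !hornerM mulf_div.
have [p [q [q0 fE pq]]] := wP f; have [p' [q' [q'0 f'E pq']]] := wP f'.
have sumE : f + f' = (p * q' + p' * q)%:F / (q * q')%:F.
  by rewrite fE f'E addf_div ?tofrac_eq0 // tofracD !tofracM.
have near_sum := nest_val_near (wP _) (mulf_neq0 q0 q'0) sumE.
have [c [[<- [<- <-]] [qc q'c]]] := near_ex (near_and
  (near_and near_sum (near_and pq pq')) (near_and (near_neq0 q0) (near_neq0 q'0))).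
have -> : (p * q' + p' * q).[c] / (q * q').[c] = p.[c] / q.[c] + p'.[c] / q'.[c].
  by rewrite addf_div // hornerD !hornerM.
exact: Hv.2.2.
Qed.

(** * The eventual-value valuation is induced by the nest and valuation-algebraic *)

Section NestValuation.
Variables (w : {fraction {poly L}} -> option G) (Hw : is_valuation w).
Hypothesis wP : forall f, nest_val f (w f).

Lemma nest_val_poly p : near (fun c => v p.[c] = w p%:F).
Proof.
have pE : p%:F = p%:F / 1%:F by rewrite tofrac1 divr1.
apply: near_mono (nest_val_near (wP _) (oner_neq0 _) pE) => c.
by rewrite hornerC divr1.
Qed.

Lemma nest_val_extends c : w c%:P%:F = v c.
Proof.
by have [x <-] := near_ex (nest_val_poly c%:P); rewrite hornerC.
Qed.

Lemma nest_val_induced : induced_by v N w.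
Proof.
apply: val_induced_by => [|B p NB Bp]; first exact: val0.
have [C [NC Cp]] := nest_val_poly p.
have [D [_ [DB DC]]] := nest_inter NB NC.
have DD := ball_center Hv D.
by rewrite -(Cp D.1 (DC _ DD)); apply: (root_free_val HG Hv Bp (DB _ DD) _);
  apply: ball_center.
Qed.

(* The residue of [f] is that of its value [b] at the center of a ball free of
   zeros and poles of [f]. *)
Lemma nest_val_residue f : ole (Some 0) (w f) ->
  exists b, ole (Some 0) (v b) /\ olt (Some 0) (w (f - b%:P%:F)).
Proof.
have [p [q [q0 fE pq]]] := wP f => wf.
have [p0|p0] := eqVneq p 0.
  by exists 0; rewrite polyC0 tofrac0 subr0 fE p0 tofrac0 mul0r !val0.
have [C [NC Cpq]] := pq.
have [E [NE Epq]] := nest_root_free (mulf_neq0 p0 q0).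
have [B [NB [BC BE]]] := nest_inter NC NE.
have [Bp Bq] := root_freeM (root_free_sub BE Epq).
have BB := ball_center Hv B; set a := B.1 in BB.
pose b := p.[a] / q.[a]; have vb : v b = w f by apply/Cpq/BC.
exists b; split; first by rewrite vb.
have qF0 : q%:F != 0 by rewrite tofrac_eq0.
have fbE : f - b%:P%:F = (p - b%:P * q)%:F / q%:F.
  by rewrite tofracB tofracM mulrBl mulfK // -fE.
have [F [NF Fpq]] := nest_val_near (wP _) q0 fbE.
have [D [ND [DB DF]]] := nest_inter NB NF.
have DD := ball_center Hv D; set c := D.1 in DD.
have Bc : ball v B c by apply: DB.
rewrite -(Fpq c (DF _ DD)).
have qc0 : q.[c] != 0 by apply: Bq.
have pa0 : p.[a] != 0 by apply: Bp.
have qa0 : q.[a] != 0 by apply: Bq.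
have b0 : b != 0 by rewrite mulf_neq0 ?invr_neq0.
have u : one_unit v (p.[c] / p.[a] * (q.[c] / q.[a])^-1).
  apply: (one_unitM HG Hv); first exact: (root_free_one_unit HG Hv Bp Bc BB).
  exact/(one_unitV HG Hv)/(root_free_one_unit HG Hv Bq Bc BB).
(* Here f (c) - b = b (f (c) / f (a) - 1), where f (c) / f (a) is a one-unit and b has nonnegative
   value. *)
have -> : (p - b%:P * q).[c] / q.[c] =
          (p.[c] / p.[a] * (q.[c] / q.[a])^-1 - 1) * b.
  by rewrite hornerD hornerN hornerM hornerC /b; field; rewrite pa0 qa0 qc0.
rewrite (valM Hv); apply: olt_trans_le u _ => //.
by rewrite -{1}[v _]oadd0; apply: ole_add; rewrite ?ole_refl ?vb.
Qed.

Lemma nest_val_V_infty : V_infty v w.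
Proof.
split=> //; split; first exact: nest_val_extends.
(* The residue of [f] already lies in the residue field of [v], so the annihilating polynomial is
   linear. *)
move=> f /nest_val_residue[b [vb wb]]; exists ('X - b%:P); split=> [i|].
  rewrite coefB coefX coefC; apply: (valB_ge HG Hv).
    by case: eqP => _; rewrite ?val1 ?val0 ?ole_refl ?ole_None.
  by case: eqP => _; rewrite ?vb ?val0 ?ole_None.
split; first by exists 1%N; rewrite coefB coefX coefC subr0 val1.
pose iota : {rmorphism L -> _} := @FracField.tofrac {poly L} \o polyC.
rewrite -[map_poly _ _]/(map_poly iota _) rmorphB /= map_polyX map_polyC.
by rewrite hornerXsubC.
Qed.
End NestValuation.
End Nest.

Lemma is_nest_induces N : is_nest v N ->
  exists w, V_infty v w /\ induced_by v N w.
Proof.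
move=> HN; have [w [Hw wP]] := nest_val_valuation HN.
exists w.
by split; [exact: (nest_val_V_infty HN Hw wP) | exact: (nest_val_induced HN Hw wP)].
Qed.

(** * Equivalent nests and equal valuations *)

Section Injectivity.
Variables (N M : L * G -> Prop) (HN : is_nest v N) (HM : is_nest v M).
Variables (w w' : {fraction {poly L}} -> option G).
Hypotheses (Nw : induced_by v N w) (Mw' : induced_by v M w').

(** A ball of [M] inside a root-free ball of [N] is root-free too, so both valuations of [p] are
    read off at its center. *)
Lemma nest_equiv_eq_val : is_valuation w -> is_valuation w' ->
  nest_equiv v N M -> w = w'.
Proof.
move=> Hw Hw' [NM _]; apply: frac_val_ext => // p.
have [->|p0] := eqVneq p 0; first by rewrite tofrac0 !val0.
have [B [NB Bp]] := nest_root_free HN p0; have [C [MC CB]] := NM _ NB.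
have CC := ball_center Hv C.
rewrite (induced_by_val HN Nw NB Bp (CB _ CC)).
by rewrite (induced_by_val HM Mw' MC (root_free_sub CB Bp) CC).
Qed.

(** Test on X - a with [a] the center of [B]. The valuation from [N] gives it at least the radius of
    [B]; a ball [C] of [M] avoiding [a] gives it the value v (C.1 - a), which is below the radius of
    [C]. So the center of [C] lies in [B] and [C] is the smaller ball. *)
Lemma eq_val_cofinal : w = w' ->
  forall B, N B -> exists C, M C /\ ball_sub v C B.
Proof.
move=> ww' B NB; have X0 : 'X - B.1%:P != 0 by rewrite polyXsubC_eq0.
have [B' [NB' B'p]] := nest_root_free HN X0.
have [C [MC Cp]] := nest_root_free HM X0.
have [D [ND [DB DB']]] := nest_inter HN NB NB'.
have DD := ball_center Hv D; have CC := ball_center Hv C.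
have wD := induced_by_val HN Nw NB' B'p (DB' _ DD).
have := induced_by_val HM Mw' MC Cp CC.
rewrite -ww' wD !hornerXsubC => DC.
have [lt _] := ballPn HG Hv (root_free_XsubC Cp) CC.
have BC : ball v B C.1 by rewrite /ball -DC; apply: DB.
exists C; split=> // c Cc; rewrite /ball -[c](subrK C.1) -addrA.
apply: (valD_ge HG Hv) => //.
by apply: ole_trans BC _; apply: oltW; apply: olt_trans_le lt Cc.
Qed.
End Injectivity.
End Nests.

(** * Recovering a nest from a valuation-algebraic valuation *)

Section Surjectivity.
Variables (G : porderZmodType) (HG : ordered_group G).
Variables (L : closedFieldType) (v : L -> option G) (Hv : is_valuation v).
Hypothesis v_surj : forall g : G, exists c : L, v c = Some g.
Local Notation "p %:F" := (@FracField.tofrac {poly L} p) (at level 1).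
Variables (w : {fraction {poly L}} -> option G) (wV : V_infty v w).

Let Hw : is_valuation w := wV.1.
Let w_ext : forall c, w c%:P%:F = v c := wV.2.1.
Let iota : {rmorphism L -> {fraction {poly L}}} := @FracField.tofrac {poly L} \o polyC.

(** If no [b] worked, every w (f - b) would be at most 0, and [coef_val_ge] at a coefficient of [P]
    of value 0 would give w (P (f)) at most 0, against the choice of [P]. *)
Lemma V_infty_residue f : ole (Some 0) (w f) ->
  exists b, olt (Some 0) (w (f - b%:P%:F)).
Proof.
move=> wf; apply: NNPP => no_b.
have w_le0 b : ole (w (f - b%:P%:F)) (Some 0).
  by rewrite -[ole _ _]negbK -oltNge //; apply/negP => h; apply: no_b; exists b.
have [P [P_ge0 [[i Pi] wP]]] := wV.2.2 f wf.
have le_coef := @coef_val_ge G HG L v Hv _ w iota f 0 P Hw w_ext.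
have: ole (w (map_poly iota P).[f]) (Some 0).
  rewrite -Pi -[v _]oadd0 -(mul0rn G i); apply: le_coef => r _ /=.
  split; first exact: w_le0.
  (* When v r is negative, w (f - r) equals v r because w f is nonnegative; otherwise w (f - r) is
     at most 0, hence at most v r. *)
  have /orP[r0|r0] := ole_total HG (Some 0) (v r).
    exact: ole_trans (w_le0 r) r0.
  have [vr0|vr0] := eqVneq (v r) (Some 0); first by rewrite vr0; apply: w_le0.
  have r_lt : olt (w (- r%:P%:F)) (w f).
    by rewrite valN // w_ext; apply: olt_trans_le wf => //; rewrite /olt r0.
  by rewrite addrC (valD_lt HG Hw r_lt) valN // w_ext ole_refl.
by rewrite -[ole _ _]negbK -oltNge // wP.
Qed.

Lemma V_infty_XsubC a : exists g, w ('X - a%:P)%:F = Some g.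
Proof.
have := @val_neq0 _ _ w Hw ('X - a%:P)%:F; rewrite tofrac_eq0 polyXsubC_eq0.
by case: (w _) => [g _|/(_ isT)//]; exists g.
Qed.

Lemma V_infty_no_max a : exists b,
  olt (w ('X - a%:P)%:F) (w ('X - b%:P)%:F).
Proof.
have [g wa] := V_infty_XsubC a; have [c vc] := v_surj g.
have c0 : c != 0 by apply/eqP => c0; move: vc; rewrite c0 val0.
have cF0 : c%:P%:F != 0 by rewrite tofrac_eq0 polyC_eq0.
pose f := ('X - a%:P)%:F / c%:P%:F.
have wf : w f = Some 0.
  apply: (oaddI (val_neq0 Hw cF0)).
  by rewrite -(valM Hw) mulrC divfK // wa w_ext vc oadd0.
have [|b wb] := @V_infty_residue f; first by rewrite wf ole_refl.
(* Chosen so that x - (a + b c) = (f - b) c, whose value exceeds v c = w (x - a). *)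
exists (a + b * c).
have -> : ('X - (a + b * c)%:P)%:F = (f - b%:P%:F) * c%:P%:F.
  rewrite mulrBl divfK // -tofracM -tofracB.
  by rewrite polyCD polyCM opprD addrA.
rewrite (valM Hw) w_ext vc wa -[X in olt X _]oadd0 oaddC.
exact: olt_add2r.
Qed.

(** From c - a = (x - a) - (x - c). Membership thus depends on the radius alone, which makes these
    balls a chain. *)
Lemma V_infty_ballE B c : w ('X - B.1%:P)%:F = Some B.2 ->
  ball v B c <-> ole (Some B.2) (w ('X - c%:P)%:F).
Proof.
move=> wB; have eB : ('X - B.1%:P)%:F = ('X - c%:P)%:F + (c - B.1)%:P%:F.
  by rewrite -tofracD polyCB addrA subrK.
have wB_le : ole (Some B.2) (w ('X - B.1%:P)%:F) by rewrite wB ole_refl.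
rewrite /ball -w_ext; split=> h.
  have -> : ('X - c%:P)%:F = ('X - B.1%:P)%:F - (c - B.1)%:P%:F.
    by rewrite eB addrK.
  exact: (valB_ge HG Hw).
have -> : (c - B.1)%:P%:F = ('X - B.1%:P)%:F - ('X - c%:P)%:F.
  by rewrite eB addrAC subrr add0r.
exact: (valB_ge HG Hw).
Qed.

(* One ball for each value of [w (x - a)]: the center is normalised by [choose],
   since distinct members of a nest must be distinct balls. *)
Definition nest_of (B : L * G) : Prop :=
  let center a := w ('X - a%:P)%:F == Some B.2 in
  center B.1 /\ choose center B.1 = B.1.

Lemma nest_of_ex a g : w ('X - a%:P)%:F = Some g -> exists b, nest_of (b, g).
Proof.
move=> /eqP wa; pose center a := w ('X - a%:P)%:F == Some g.
have cb : center (choose center a) by apply: chooseP.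
exists (choose center a); split=> //=.
exact: choose_id.
Qed.

Lemma nest_of_val B : nest_of B -> w ('X - B.1%:P)%:F = Some B.2.
Proof. by case=> /eqP. Qed.

(** As [v] is surjective, [B] contains two points whose difference has value exactly its radius. *)
Lemma ball_radius_le B C : nest_of B -> nest_of C -> ball_sub v B C -> C.2 <= B.2.
Proof.
move=> NB NC BC; have [c vc] := v_surj B.2.
have C1 : ball v C B.1 := BC _ (ball_center Hv B).
have C2 : ball v C (B.1 + c).
  by apply: BC; rewrite /ball addrC addKr vc ole_refl.
have : ole (Some C.2) (v ((B.1 + c - C.1) - (B.1 - C.1))).
  exact: (valB_ge HG Hv).
by rewrite opprB addrA subrK addrC addKr vc.
Qed.

Lemma nest_of_is_nest : is_nest v nest_of.
Proof.
split=> [B C NB NC|]; [|split=> [B C NB NC eBC|[c c_in]]].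
- have wB := nest_of_val NB; have wC := nest_of_val NC.
  have /orP[le|le] := HG.1 B.2 C.2; [right|left] => c;
    rewrite !V_infty_ballE //; exact: ole_trans.
- have r_eq : B.2 = C.2.
    by apply: le_anti; rewrite !ball_radius_le // => c /eBC.
  case: B C NB NC r_eq {eBC} => [b g] [c h] [/= wb eb] [/= wc ec] gh.
  by subst h; rewrite -eb -ec; congr pair; apply: choose_id.
(* A point [c] common to all balls would lie in the one of radius w (x - b), giving w (x - c) at
   least w (x - b), against the choice of [b]. *)
have [b lt] := V_infty_no_max c; have [g wb] := V_infty_XsubC b.
have [a Na] := nest_of_ex wb.
have /(V_infty_ballE _ (nest_of_val Na)) := c_in _ Na.
by rewrite -wb -[ole _ _]negbK -oltNge // lt.
Qed.

Lemma nest_of_induced : induced_by v nest_of w.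
Proof.
apply: (val_induced_by HG Hv nest_of_is_nest) => [|B p NB]; first exact: val0.
elim/closed_poly_ind: p => [c|p r IH] Bp; first by rewrite hornerC w_ext.
have [/IH wp rB] := root_freeM Bp.
have wB := nest_of_val NB.
rewrite tofracM (valM Hw) wp hornerM (valM Hv) hornerXsubC.
congr oadd; rewrite -w_ext.
have rB' := root_free_XsubC rB.
(* In x - r = (B.1 - r) + (x - B.1) the first term has strictly smaller value, [r] being outside
   [B]. *)
have lt : olt (w (B.1 - r)%:P%:F) (w ('X - B.1%:P)%:F).
  by rewrite wB w_ext valBC // oltNge.
rewrite -(valD_lt HG Hw lt) -tofracD; congr (w _%:F).
by rewrite polyCB [RHS]addrC addrA subrK.
Qed.
End Surjectivity.

Theorem theorem2p2 (L : closedFieldType) 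
  (Gamma : porderZmodType) (vbar : L -> option Gamma) :
  ordered_group Gamma ->
  is_valuation vbar ->
  (forall g : Gamma, exists c : L, vbar c = Some g) ->
  (* well defined: every nest induces a valuation-algebraic valuation *)
  (forall N, is_nest vbar N -> exists w, V_infty vbar w /\ induced_by vbar N w) /\
  (* equivalent nests give the same valuation, and conversely (injectivity) *)
  (forall N M w w', is_nest vbar N -> is_nest vbar M ->
     V_infty vbar w -> V_infty vbar w' ->
     induced_by vbar N w -> induced_by vbar M w' ->
     (nest_equiv vbar N M <-> w = w')) /\
  (* surjectivity *)
  (forall w, V_infty vbar w -> exists N, is_nest vbar N /\ induced_by vbar N w).
Proof.
move=> HG Hv v_surj; split; first by move=> N; apply: is_nest_induces.
split=> [N M w w' HN HM wV w'V Nw Mw'|w wV].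
  split=> [|ww']; first exact: (nest_equiv_eq_val HG Hv HN HM Nw Mw' wV.1 w'V.1).
  split; first exact: (eq_val_cofinal HG Hv HN HM Nw Mw' ww').
  exact: (eq_val_cofinal HG Hv HM HN Mw' Nw (esym ww')).
exists (nest_of w); split; first exact: (nest_of_is_nest HG Hv v_surj wV).
exact: (nest_of_induced HG Hv v_surj wV).
Qed.
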